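(* Let $\mathcal{A}$ be a finite alphabet and let $\mu$ be a Markov random field on $\mathcal{A}^{\mathbb{Z}^2}$ that satisfies strong spatial mixing with rate $f(n)=Ce^{-\alpha n}$ for some constants $C>0$ and $\alpha$ with $\alpha>4\log|\mathcal{A}|$. Then $\operatorname{supp}(\mu)$ satisfies topological strong spatial mixing (TSSM).
   Context: Lattice: $\mathbb{Z}^d$ is viewed as a graph with $p\sim q$ iff $\|p-q\|=1$, where $\|p\|=\sum_i|p_i|$; $\operatorname{dist}(A,B)=\min_{p\in A,q\in B}\|p-q\|$ (with value $\infty$ if one of the sets is empty). For $S\subseteq\mathbb{Z}^d$, $\partial S=\{p\notin S:\operatorname{dist}(\{p\},S)=1\}$. A configuration on $S\subseteq\mathbb{Z}^d$ is an element $u\in\mathcal{A}^S$; $x(S)$ denotes restriction to $S$. The shift is $(\sigma_p x)(q)=x(p+q)$. A shift space is a closed, shift-invariant subset $X\subseteq\mathcal{A}^{\mathbb{Z}^d}$. For $u\in\mathcal{A}^S$, $[u]_X=\{x\in X:x(S)=u\}$, and for several configurations $[us]_X=[u]_X\cap[s]_X$, etc. Measures: measures are Borel probability measures on $\mathcal{A}^{\mathbb{Z}^d}$; $\mu(u)$ denotes the measure of $\{x:x(S)=u\}$ for $u\in\mathcal{A}^S$. $\operatorname{supp}(\mu)=\{x:\mu(x(S))>0\text{ for all finite }S\subset\mathbb{Z}^d\}$. A shift-invariant measure $\mu$ is a Markov random field (MRF) if for every finite $S$, $u\in\mathcal{A}^S$, finite $T$ with $\partial S\subseteq T\subseteq\mathbb{Z}^d\setminus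 S$, and $\delta\in\mathcal{A}^T$ with $\mu(\delta)>0$, $\mu(u\mid\delta)=\mu(u\mid\delta(\partial S))$. For $\delta\in\mathcal{A}^{\partial S}$ with $\mu(\delta)>0$, write $\mu^\delta(\cdot)=\mu(\cdot\mid\delta)$. Strong spatial mixing: for $f:\mathbb{N}\to\mathbb{R}_{\ge0}$ with $f(n)\to0$ (and $f(\infty)=0$), an MRF $\mu$ satisfies strong spatial mixing (SSM) with rate $f(n)$ if for every finite $W\subset\mathbb{Z}^d$, $U\subseteq W$, $u\in\mathcal{A}^U$ and $\delta_1,\delta_2\in\mathcal{A}^{\partial W}$ with $\mu(\delta_1),\mu(\delta_2)>0$, $|\mu^{\delta_1}(u)-\mu^{\delta_2}(u)|\le|U|\,f(\operatorname{dist}(U,\Sigma))$, where $\Sigma=\{p\in\partial W:\delta_1(p)\ne\delta_2(p)\}$. TSSM: a shift space $X$ satisfies topological strong spatial mixing with gap $g$ if for all finite $U,V,S\subset\mathbb{Z}^d$ (possibly empty) with $\operatorname{dist}(U,V)\ge g$ and all $u\in\mathcal{A}^U$, $v\in\mathcal{A}^V$, $s\in\mathcal{A}^S$: $[us]_X\ne\emptyset$ and $[sv]_X\neq\emptyset$ imply $[usv]_X\ne\emptyset$. $X$ satisfies TSSM if it satisfies TSSM with gap $g$ for some $g\in\mathbb{N}$. *)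

(* Defs.v *)
(* Markov random fields and (topological) strong spatial mixing on Z^d,
   over MathComp-Analysis. *)
From HB Require Import structures.
From mathcomp Require Import all_boot all_order all_algebra finmap.
From mathcomp Require Import all_classical all_reals all_analysis.

Set Implicit Arguments.
Unset Strict Implicit.
Unset Printing Implicit Defensive.

Import Order.TTheory GRing.Theory Num.Theory.
Import numFieldNormedType.Exports.
Local Open Scope classical_set_scope.
Local Open Scope ring_scope.

(* A measurableType must be pointed. Pointedness only says that the alphabet is
   nonempty, which any probability measure on A^(Z^d) forces anyway. *)
#[short(type="alphabetType")]
HB.structure Definition Alphabet := {A of Finite A & Pointed A}.

Definition site (d : nat) := 'rV[int]_d.

Definition norm1 (d : nat) (p : site d) : nat := (\sum_(i < d) `|p 0%R i|%N)%N.

(* None stands for the value infinity, taken when A or B is empty. *)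
Definition dist (d : nat) (A B : set (site d)) : option nat :=
  match pselect (exists n, `[< exists p q, [/\ A p, B q & norm1 (p - q) = n] >])
  with
  | left ex => Some (ex_minn ex)
  | right _ => None
  end.

Definition dist_ge (d : nat) (A B : set (site d)) (g : nat) : Prop :=
  if dist A B is Some n then (g <= n)%N else True.

Definition boundary (d : nat) (S : set (site d)) : set (site d) :=
  [set p | ~ S p /\ dist [set p] S = Some 1%N].

(* A configuration on S : set (site d) has type S -> A, where S is coerced to
   the type of its elements. Configurations on the whole of Z^d carry the
   product of the discrete topologies. *)
Definition fullconf (d : nat) (A : alphabetType) :=
  prod_topology (fun _ : site d => discrete_topology A).

Definition borel_fullconf (d : nat) (A : alphabetType) :=
  g_sigma_algebraType (@open (fullconf d A)).

Definition restr (d : nat) (A : alphabetType) (S : set (site d))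
    (x : fullconf d A) : S -> A :=
  fun p => x (set_val p).
Arguments restr {d A} S x.

Definition subrestr (d : nat) (A : alphabetType) (S T : set (site d))
    (ST : S `<=` T) (w : T -> A) : S -> A :=
  fun p => w (SigSub (mem_set (ST _ (set_valP p)))).

Definition cyl (d : nat) (A : alphabetType) (S : set (site d)) (u : S -> A) :
    set (fullconf d A) :=
  [set x | restr S x = u].

Definition shiftconf (d : nat) (A : alphabetType) (p : site d) (x : fullconf d A) :
    fullconf d A :=
  fun q => x (p + q).

Definition shift_space (d : nat) (A : alphabetType) (X : set (fullconf d A)) :
    Prop :=
  closed X /\ forall p : site d, shiftconf p @` X = X.

Section measures.
Context {R : realType} {d : nat} {A : alphabetType}.
Implicit Types (mu : probability (borel_fullconf d A) R).

Definition condp mu (E F : set (fullconf d A)) : R :=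
  fine (mu (E `&` F)) / fine (mu F).

Definition shift_invariant mu : Prop :=
  forall (p : site d) (E : set (borel_fullconf d A)),
    measurable E -> mu (shiftconf p @^-1` E) = mu E.

Definition msupport mu : set (fullconf d A) :=
  [set x | forall S : set (site d), finite_set S ->
    (0 < mu (cyl (restr S x)))%E].

Definition is_MRF mu : Prop :=
  shift_invariant mu /\
  forall (S : set (site d)) (u : S -> A) (T : set (site d))
      (bT : boundary S `<=` T) (delta : T -> A),
    finite_set S -> finite_set T -> T `<=` ~` S ->
    (0 < mu (cyl delta))%E ->
    condp mu (cyl u) (cyl delta) = condp mu (cyl u) (cyl (subrestr bT delta)).

Definition discrepancy (W : set (site d)) (delta1 delta2 : boundary W -> A) :
    set (site d) :=
  set_val @` [set p : boundary W | delta1 p <> delta2 p].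

(* The convention f(infinity) = 0. *)
Definition rate_at (f : nat -> R) (n : option nat) : R :=
  if n is Some m then f m else 0.

Definition SSM mu (f : nat -> R) : Prop :=
  [/\ forall n, 0 <= f n,
      f @ \oo --> (0 : R) &
      forall (W U : set (site d)) (u : U -> A) (delta1 delta2 : boundary W -> A),
        finite_set W -> U `<=` W ->
        (0 < mu (cyl delta1))%E -> (0 < mu (cyl delta2))%E ->
        `|condp mu (cyl u) (cyl delta1) - condp mu (cyl u) (cyl delta2)|
          <= #|` fset_set U|%fset%:R
             * rate_at f (dist U (discrepancy delta1 delta2))].

End measures.

Definition TSSM_gap (d : nat) (A : alphabetType) (X : set (fullconf d A))
    (g : nat) : Prop :=
  forall (U V S : set (site d)) (u : U -> A) (v : V -> A) (s : S -> A),
    finite_set U -> finite_set V -> finite_set S -> dist_ge U V g ->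
    X `&` cyl u `&` cyl s !=set0 ->
    X `&` cyl s `&` cyl v !=set0 ->
    X `&` cyl u `&` cyl s `&` cyl v !=set0.

Definition TSSM (d : nat) (A : alphabetType) (X : set (fullconf d A)) : Prop :=
  shift_space X /\ exists g : nat, TSSM_gap X g.

(* Main.v *)
(** Let [x] and [y] lie in the support and agree on a finite set [S], and let
    [p] be a site outside [S]. Condition [mu] on the values of [x], respectively
    [y], on the boundary of [W], the punctured ball of radius [2r] around [p]
    with [S] removed. The sphere [D] of radius [r] has at most [4r + 2] sites,
    so some pattern [w] on [D] without [S] has conditional probability at least
    [|A|^-(4r + 2)] given [x]. The two boundary conditions differ only at
    distance at least [r] from [D], and [alpha > 4 ln |A|] makes the SSM bound
    smaller than that probability for large [r], so [w] also has positive
    probability given [y]. Hence [x] and [y] can both be modified inside [W] so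
    as to carry [w] on [D], and by the Markov property they can then be spliced
    along [D]: the result agrees with [x] at [p] and on [S], and with [y] at
    distance at least [2r] from [p]. Treating the sites of [U] one at a time
    gives TSSM with gap [2r]. *)
Require Import Defs.
From HB Require Import structures.
From mathcomp Require Import all_boot all_order all_algebra finmap.
From mathcomp Require Import all_classical all_reals all_analysis.
From mathcomp Require Import zify ring lra.

Import Order.TTheory GRing.Theory Num.Theory.
Import numFieldNormedType.Exports.
Local Open Scope classical_set_scope.
Local Open Scope ring_scope.

(** * The l1 norm, distances and the size of spheres *)

Lemma norm1D {d} (p q : site d) : (norm1 (p + q)%R <= norm1 p + norm1 q)%N.
Proof.
rewrite /norm1 -big_split; apply: leq_sum => i _ /=.
rewrite mxE; set a := p _ _; set b := q _ _; lia.
Qed.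

Lemma norm1N {d} (p : site d) : norm1 (- p) = norm1 p.
Proof. by apply: eq_bigr => i _; rewrite mxE abszN. Qed.

Lemma norm1B {d} (p q : site d) : norm1 (p - q)%R = norm1 (q - p)%R.
Proof. by rewrite -norm1N opprB. Qed.

Lemma norm1_trans {d} (q p r : site d) :
  (norm1 (p - r)%R <= norm1 (p - q)%R + norm1 (q - r)%R)%N.
Proof. by rewrite -[p - r](subrKA q) norm1D. Qed.

Lemma norm1_0 {d} : norm1 (0 : site d) = 0%N.
Proof. by rewrite /norm1 big1 // => i _; rewrite mxE. Qed.

Lemma norm1_eq0 {d} (p : site d) : norm1 p = 0%N -> p = 0.
Proof.
move=> /eqP; rewrite sum_nat_eq0 => /forallP p0.
by apply/rowP => i; rewrite mxE; apply/eqP; rewrite -absz_eq0; exact: p0.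
Qed.

Lemma dist_Some {d} (B B' : set (site d)) n : dist B B' = Some n ->
  exists p q, [/\ B p, B' q & norm1 (p - q)%R = n].
Proof.
rewrite /dist; case: pselect => // ex [<-].
by case: ex_minnP => m /asboolP.
Qed.

Lemma dist_geP {d} (B B' : set (site d)) g p q :
  dist_ge B B' g -> B p -> B' q -> (g <= norm1 (p - q)%R)%N.
Proof.
move=> + Bp B'q; rewrite /dist_ge /dist; case: pselect => [ex|nex].
  case: ex_minnP => m _ min gm; apply: (leq_trans gm); apply: min.
  by apply/asboolP; exists p, q.
by move=> _; case: nex; exists (norm1 (p - q)%R); apply/asboolP; exists p, q.
Qed.

Lemma boundary_neighbor {d} (S : set (site d)) p : boundary S p ->
  exists2 q, S q & norm1 (p - q)%R = 1%N.
Proof. by case=> _ /dist_Some[_ [q [-> Sq pq]]]; exists q. Qed.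

Lemma finite_norm1_ball {d} (p : site d) n :
  finite_set [set q | (norm1 (q - p)%R < n)%N].
Proof.
(* The ball lies in the cube of side 2n + 1 centred at [p], which [g] parametrizes by a finite
   type. *)
pose g (f : {ffun 'I_d -> 'I_(n.*2.+1)}) : site d :=
  p + \row_i ((f i)%:Z - n%:Z).
apply: (@sub_finite_set _ _ (g @` setT)); last exact/finite_image/finite_finset.
move=> q /= qn.
have lti i : (`|((q - p) 0 i + n%:Z)%R| < n.*2.+1)%N.
  have : (`|((q - p) 0 i)%R| <= norm1 (q - p)%R)%N.
    by rewrite /norm1 (bigD1 i) //= leq_addr.
  by move: qn; set N := norm1 _; set z := _ 0 i; lia.
exists [ffun i => Ordinal (lti i)] => //.
rewrite /g; apply/eqP; rewrite eq_sym addrC -subr_eq; apply/eqP/rowP => i.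
have : (`|((q - p) 0 i)%R| <= norm1 (q - p)%R)%N.
  by rewrite /norm1 (bigD1 i) //= leq_addr.
rewrite [in RHS]mxE ffunE /=.
by move: qn; set N := norm1 _; set z := _ 0 i; lia.
Qed.

Lemma finite_boundary {d} (S : set (site d)) :
  finite_set S -> finite_set (boundary S).
Proof.
move=> finS; apply: (@sub_finite_set _ _
  (\bigcup_(q in S) [set p | (norm1 (p - q)%R < 2)%N])).
  by move=> p /boundary_neighbor[q Sq pq]; exists q => //=; rewrite pq.
by apply: bigcup_finite => // q _; exact: finite_norm1_ball.
Qed.

(** Relative to [p], a point of the sphere is determined by its first coordinate, which takes 2r + 1
    values, and by the sign of its second. The two points with second coordinate 0 are counted
    twice. *)
Lemma card_sphere (p : site 2) r (U : set (site 2)) :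
  (forall q, U q -> norm1 (q - p)%R = r) -> (#|` fset_set U| <= 4 * r + 2)%N.
Proof.
move=> Ur.
pose g (k : 'I_(r.*2.+1) * bool) : site 2 := p + \row_(i < 2)
  (if i == 0 then k.1%:Z - r%:Z else
   (-1) ^+ k.2 * (r%:Z - `|k.1%:Z - r%:Z|)).
have finU : finite_set U.
  apply: sub_finite_set (finite_norm1_ball p r.+1) => q /Ur /= ->; exact: ltnSn.
have UsubG : {subset fset_set U <= [seq g k | k : 'I_(r.*2.+1) * bool]}.
  move=> q; rewrite in_fset_set// inE => /Ur.
  rewrite /norm1 big_ord_recl big_ord1 => qr.
  have lt1 : (`|((q - p) 0 0 + r%:Z)%R| < r.*2.+1)%N.
    by move: qr; set a := _ 0 0; lia.
  apply/mapP; exists (Ordinal lt1, (q - p) 0 (lift ord0 ord0) < 0).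
    by rewrite mem_enum.
  apply/rowP => i; rewrite /g /= !mxE /=; move: qr; rewrite !mxE.
  case: (unliftP 0 i) => [j|] ->; last first.
    rewrite eqxx; set a := q _ _; set b := p _ _; lia.
  rewrite (ord1 j) /= mulr_sign.
  set a := q _ 0; set b := p _ 0; set c := q _ _; set e := p _ _.
  by case: ifP; lia.
apply: leq_trans (uniq_leq_size (fset_uniq _) UsubG) _.
rewrite size_map -cardE card_prod card_ord card_bool; lia.
Qed.

(** * Cylinders and the support of a measure *)

Lemma cyl_restrP {d} {A : alphabetType} (S : set (site d)) (x z : fullconf d A) :
  cyl (restr S x) z <-> forall p, S p -> z p = x p.
Proof.
split=> [zx p Sp|zx].
  exact: (congr1 (fun u : S -> A => u (SigSub (mem_set Sp))) zx).
by apply/funext => p; apply: zx; exact: set_valP.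
Qed.

Lemma restr_ext {d} {A : alphabetType} (S : set (site d)) (x z : fullconf d A) :
  (forall p, S p -> z p = x p) -> restr S z = restr S x.
Proof. by move=> /cyl_restrP. Qed.

Lemma open_cyl {d} {A : alphabetType} (S : set (site d)) (x : fullconf d A) :
  finite_set S -> open (cyl (restr S x)).
Proof.
move=> /finite_seqP[s ->].
rewrite (_ : cyl _ = [set z | forall p, p \in s -> z p = x p]); last first.
  by apply/seteqP; split=> z /cyl_restrP.
elim: s => [|p s IHs].
  by rewrite (_ : [set z | _] = setT); [exact: openT|exact/seteqP].
rewrite (_ : [set z | _] = proj p @^-1` [set x p] `&`
    [set z : fullconf d A | forall q, q \in s -> z q = x q]); last first.
  apply/seteqP; split=> [z zx|z [/= zp zx] q].
    by split=> [|q qs]; apply: zx; rewrite inE ?eqxx ?qs ?orbT.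
  by rewrite inE => /orP[/eqP -> //|]; exact: zx.
apply: openI => //; apply: open_comp => [z _|]; first exact: proj_continuous.
exact: discrete_open.
Qed.

Lemma measurable_cyl {d} {A : alphabetType} (S : set (site d))
    (x : fullconf d A) :
  finite_set S ->
  measurable (cyl (restr S x) : set (borel_fullconf d A)).
Proof. by move=> finS; apply: sub_sigma_algebra; exact: open_cyl. Qed.

(* The complement of the support is a countable union of null cylinders. *)
Lemma msupport_pos {R : realType} {d} {A : alphabetType}
    (mu : probability (borel_fullconf d A) R) (E : set (borel_fullconf d A)) :
  measurable E -> (0 < mu E)%E -> msupport mu `&` E !=set0.
Proof.
move=> mE; apply: contraPP => /set0P/negP/negPn/eqP E0.
suff : mu E = 0%E by move=> ->; rewrite ltxx.
apply: measure_negligible => //.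
(* Finite lists of site-value pairs form a countable type, so [unpickle] enumerates all cylinders;
   [F] keeps the null ones. *)
pose box (l : seq (site d * A)) : set (borel_fullconf d A) :=
  [set z | forall pa, pa \in l -> z pa.1 = pa.2].
pose F n : set (borel_fullconf d A) :=
  if (choice.unpickle n : option (seq (site d * A))) is Some l then
    if pselect (mu.-negligible (box l)) then box l else set0
  else set0.
apply: (@negligibleS _ _ _ _ (\bigcup_n F n)); last first.
  apply: negligible_bigcup => n; rewrite /F.
  case: choice.unpickle => [l|]; last exact: negligible_set0.
  by case: pselect => [nl|nl]; [exact: nl|exact: negligible_set0].
move=> x Ex; have : ~ msupport mu x.
  by move=> sx; have : (msupport mu `&` E) x by []; rewrite E0.
move=> /existsNP[S /not_implyP[finS]].
move/negP; rewrite lt_neqAle measure_ge0 andbT negbK => /eqP S0.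
have [s Ss] := (finite_seqP _).1 finS.
pose l := [seq (p, x p) | p <- s].
have boxl : box l = cyl (restr S x).
  apply/seteqP; split=> z.
    move=> zl; apply/cyl_restrP => p; rewrite Ss /= => ps.
    by have := zl (p, x p); apply; exact: map_f.
  by move=> /cyl_restrP zx _ /mapP[p ps ->]; apply: zx; rewrite Ss.
exists (choice.pickle l) => //; rewrite /F choice.pickleK.
case: pselect => [nl|[]] /=.
  by rewrite boxl; exact/cyl_restrP.
by rewrite boxl; apply/negligibleP => //; exact: measurable_cyl.
Qed.

Lemma closed_msupport {R : realType} {d} {A : alphabetType}
    (mu : probability (borel_fullconf d A) R) : closed (msupport mu).
Proof.
move=> x clx S finS.
have nbx : nbhs x (cyl (restr S x)).
  by apply: open_nbhs_nbhs; split; [exact: open_cyl|exact/cyl_restrP].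
have [z [mz /cyl_restrP zx]] := clx _ nbx.
by rewrite -(restr_ext _ _ _ zx); exact: mz.
Qed.

Lemma shift_space_msupport {R : realType} {d} {A : alphabetType}
    (mu : probability (borel_fullconf d A) R) :
  shift_invariant mu -> shift_space (msupport mu).
Proof.
move=> shmu; split; first exact: closed_msupport.
have sub p x : msupport mu x -> msupport mu (shiftconf p x).
  move=> mx S finS; rewrite -(shmu p); last exact: measurable_cyl.
  rewrite (_ : _ @^-1` _ = cyl (restr [set p + q | q in S] x)).
    by apply: mx; exact: finite_image.
  apply/seteqP; split=> z.
    by move=> /cyl_restrP zx; apply/cyl_restrP => _ [q Sq <-]; exact: zx.
  by move=> /cyl_restrP zx; apply/cyl_restrP => q Sq; apply: zx; exists q.
move=> p; apply/seteqP; split=> [_ [x mx <-]|x mx]; first exact: sub.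
exists (shiftconf (- p) x); first exact: sub.
by apply/funext => q; rewrite /shiftconf addKr.
Qed.

(** * Conditioning and splicing within the support *)

Lemma condp_gt0 {R : realType} {d} {A : alphabetType}
    (mu : probability (borel_fullconf d A) R) (E F : set (borel_fullconf d A)) :
  measurable E -> measurable F -> (0 < mu F)%E ->
  (0 < condp mu E F) = (0 < mu (E `&` F))%E.
Proof.
move=> mE mF F0; have mEF := measurableI _ _ mE mF.
have fin G : measurable G -> mu G \is a fin_num by move=> ?; exact: fin_num_measure.
have {}F0 : 0 < fine (mu F) by apply: fine_gt0; rewrite F0 ltey_eq fin.
by rewrite /condp pmulr_lgt0 ?invr_gt0// -lte_fin fineK ?fin.
Qed.

Definition splice {d} {A : alphabetType} (P : set (site d)) (x y : fullconf d A) :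
    fullconf d A :=
  fun q => if `[< P q >] then x q else y q.

Lemma splice_in {d} {A : alphabetType} (P : set (site d)) (x y : fullconf d A) q :
  P q -> splice P x y q = x q.
Proof. by move=> Pq; rewrite /splice asboolT. Qed.

Lemma splice_out {d} {A : alphabetType} (P : set (site d)) (x y : fullconf d A) q :
  ~ P q -> splice P x y q = y q.
Proof. by move=> Pq; rewrite /splice asboolF. Qed.

(** By the Markov property, the pattern of [x] on [P] is as likely given [y] on a larger set outside
    [P] as given [y] on the boundary alone. There [y] agrees with [x], so this probability is
    positive. *)
Lemma msupport_splice {R : realType} {d} {A : alphabetType}
    (mu : probability (borel_fullconf d A) R) (P : set (site d))
    (x y : fullconf d A) :
  is_MRF mu -> finite_set P -> msupport mu x -> msupport mu y ->
  (forall q, boundary P q -> x q = y q) -> msupport mu (splice P x y).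
Proof.
move=> [_ mrf] finP mx my xy F finF.
(* Prescribing [x] on [P] and [y] on [T] fixes the spliced configuration on all of [F]. *)
pose T : set (site d) := boundary P `|` (F `\` P).
have finbP := finite_boundary _ finP.
have finT : finite_set T by rewrite finite_setU; split=> //; exact: finite_setD.
have bT : boundary P `<=` T by exact: subsetUl.
have TP : T `<=` ~` P by move=> q [[]|[]].
have := mrf P (restr P x) T bT (restr T y) finP finT TP (my _ finT).
rewrite (_ : subrestr bT (restr T y) = restr (boundary P) y) //.
rewrite -(restr_ext (boundary P) y x xy) => mrfE.
have : 0 < condp mu (cyl (restr P x)) (cyl (restr T y)).
  rewrite mrfE condp_gt0; try exact: measurable_cyl; last exact: mx.
  rewrite (_ : _ `&` _ = cyl (restr (P `|` boundary P) x)).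
    by apply: mx; rewrite finite_setU.
  apply/seteqP; split=> z.
    by move=> [/cyl_restrP zx /cyl_restrP zy]; apply/cyl_restrP => q [/zx|/zy].
  by move=> /cyl_restrP zx; split; apply/cyl_restrP => q Sq; apply: zx; [left|right].
rewrite condp_gt0; try exact: measurable_cyl; last exact: my.
move=> /lt_le_trans; apply; apply: le_measure; rewrite ?inE.
- by apply: measurableI; exact: measurable_cyl.
- exact: measurable_cyl.
move=> z [/cyl_restrP zx /cyl_restrP zy]; apply/cyl_restrP => q Fq.
have [Pq|nPq] := pselect (P q); first by rewrite splice_in // zx.
by rewrite splice_out // zy //; right.
Qed.

(** * Patterns of large probability *)

Lemma measurable_value {d} {A : alphabetType} (p : site d) (a : A) :
  measurable ([set z | z p = a] : set (borel_fullconf d A)).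
Proof.
rewrite (_ : [set z | _] = cyl (restr [set p] (cst a : fullconf d A))).
  exact: measurable_cyl.
apply/seteqP; split=> z; first by move=> zp; apply/cyl_restrP => _ ->.
by move=> /cyl_restrP; exact.
Qed.

(** The value at [p] cuts [E] into #|A| disjoint pieces, and the heaviest has at least the average
    mass. *)
Lemma likely_value {R : realType} {d} {A : alphabetType}
    (mu : probability (borel_fullconf d A) R) (p : site d)
    (E : set (borel_fullconf d A)) : measurable E ->
  exists a, fine (mu E) <= #|A|%:R * fine (mu (E `&` [set z | z p = a])).
Proof.
move=> mE; pose Ea a := E `&` [set z : fullconf d A | z p = a].
have mEa a : measurable (Ea a : set (borel_fullconf d A)).
  by apply: measurableI => //; exact: measurable_value.
pose m a := fine (mu (Ea a)).
have mE_sum : mu E = (\sum_a (m a)%:E)%E.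
  rewrite {1}(_ : E = \bigcup_(a in [set` enum A]) Ea a); last first.
    by apply/seteqP; split=> [z Ez|z [a _ []]//]; exists (z p); rewrite //= mem_enum.
  rewrite measure_fin_bigcup //; last 1 first.
  - by move=> a b _ _ [z [[_ <-] [_ <-]]].
  - rewrite -fsbig_seq ?enum_uniq // big_enum /=.
    by apply: eq_bigr => a _; rewrite fineK // fin_num_measure.
exists [arg max_(a > point) m a]%O; rewrite mE_sum sumEFin /=.
case: arg_maxP => //= b _ bmax.
rewrite mulr_natl -sumr_const; apply: ler_sum => a _; exact: bmax.
Qed.

Lemma likely_pattern {R : realType} {d} {A : alphabetType}
    (mu : probability (borel_fullconf d A) R) (s : seq (site d))
    (E : set (borel_fullconf d A)) : measurable E ->
  exists w, fine (mu E) <=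
    #|A|%:R ^+ size s * fine (mu (E `&` cyl (restr [set` s] w))).
Proof.
elim: s E => [|p s IHs] E mE.
  exists (cst point); rewrite mul1r (_ : cyl _ = setT) ?setIT//.
  by apply/seteqP; split=> [|z _]; [exact: subsetT|exact/cyl_restrP].
have [a Ea] := likely_value mu p E mE.
have mEp := measurableI _ _ mE (measurable_value p a).
have [w Ew] := IHs _ mEp.
(* Should [p] occur again in [s], the value [a] prevails; only an inclusion of events is needed, so
   no duplicate-freeness is assumed. *)
exists (fun q => if q == p then a else w q).
apply: (le_trans Ea); rewrite exprS -mulrA; apply: ler_wpM2l => //.
apply: (le_trans Ew); apply: ler_wpM2l; first exact: exprn_ge0.
have mI (x : fullconf d A) (t : seq (site d)) (B : set (borel_fullconf d A)) :
    measurable B -> measurable (B `&` cyl (restr [set` t] x)).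
  move=> mB; apply: (measurableI _ _ mB); apply: measurable_cyl; apply: finite_seq.
apply: fine_le; rewrite ?fin_num_measure ?le_measure ?inE//; try exact: mI.
move=> z [[Ez zp] /cyl_restrP zw]; split=> //; apply/cyl_restrP => q /=.
by rewrite inE; case: eqVneq => [-> _|_ /zw].
Qed.

(** * Changing one site, then finitely many *)

Lemma single_site {R : realType} {A : alphabetType}
    (mu : probability (borel_fullconf 2 A) R) (f : nat -> R) (r : nat) :
  is_MRF mu -> SSM mu f -> (0 < r)%N ->
  (forall n, (r <= n)%N ->
    (4 * r + 2)%:R * f n * #|A|%:R ^+ (4 * r + 2) < 1) ->
  forall (p : site 2) (S : set (site 2)) (x y : fullconf 2 A),
  finite_set S -> msupport mu x -> msupport mu y ->
  (forall q, S q -> x q = y q) ->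
  exists z, [/\ msupport mu z, forall q, S q -> z q = x q, z p = x p &
    forall q, (r.*2 <= norm1 (q - p)%R)%N -> z q = y q].
Proof.
move=> mrf [f0 _ ssm] r0 fr p S x y finS mx my xy.
have [Sp|nSp] := pselect (S p).
  by exists y; split=> // [q /xy|]; rewrite ?(xy p).
(* Since [p] is left out of [W], modifications inside [W] keep the value at [p]. *)
pose W : set (site 2) := [set q | (0 < norm1 (q - p)%R < r.*2)%N] `\` S.
pose D : set (site 2) := [set q | norm1 (q - p) = r] `\` S.
pose P : set (site 2) := [set q | (norm1 (q - p)%R < r)%N] `\` S.
have finW : finite_set W.
  by apply: sub_finite_set (finite_norm1_ball p r.*2) => q [/= /andP[]].
have finP : finite_set P by apply/finite_setD/finite_norm1_ball.
have DW : D `<=` W.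
  move=> q [/= qr nSq]; split=> //=; rewrite qr r0 /=; lia.
have finD : finite_set D by exact: sub_finite_set finW.
have finbW := finite_boundary _ finW.
have cardD : (#|` fset_set D| <= 4 * r + 2)%N.
  by apply: (card_sphere p) => q [].
set dx := restr (boundary W) x; set dy := restr (boundary W) y.
have [w xw] := likely_pattern mu (fset_set D) _ (measurable_cyl _ x finbW).
rewrite fset_setK // setIC in xw.
have mu_x : (0 < mu (cyl dx))%E by exact: mx.
have mu_y : (0 < mu (cyl dy))%E by exact: my.
have fmu_x : 0 < fine (mu (cyl dx)).
  by apply: fine_gt0; rewrite mu_x ltey_eq fin_num_measure//; exact: measurable_cyl.
have A1 : 1 <= #|A|%:R :> R by rewrite ler1n; apply/card_gt0P; exists point.
have Agt0 n : 0 < #|A|%:R ^+ n :> R by rewrite exprn_gt0// (lt_le_trans ltr01).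
have cond_x : (#|A|%:R ^+ #|` fset_set D|)^-1 <= condp mu (cyl (restr D w)) (cyl dx).
  rewrite /condp ler_pdivlMr // ler_pdivrMl //.
(* A discrepancy avoids [S], where [x] and [y] agree, and avoids [W]. So it is [p] itself or lies at
   distance at least 2r from [p]; either way it is at distance at least r from the sphere. *)
have disc q t : discrepancy dx dy q -> D t -> (r <= norm1 (t - q)%R)%N.
  move=> [[q' q'P] /= dxy <-] [/= tr _].
  rewrite -[set_val _]/q'.
  have nSq : ~ S q' by move=> /xy; exact: dxy.
  have nWq : ~ W q' by case: (set_mem q'P).
  have [qp|qp] := posnP (norm1 (q' - p)).
    by rewrite (_ : q' = p) ?tr //; apply/eqP; rewrite -subr_eq0 (norm1_eq0 _ qp).
  have : (r.*2 <= norm1 (q' - p)%R)%N.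
    by rewrite leqNgt; apply/negP => lt; apply: nWq; split=> //=; rewrite qp.
  have := norm1_trans t q' p; rewrite tr (norm1B q' t).
  by move=> h /leq_trans/(_ h); rewrite -addnn leq_add2r.
have := ssm W D (restr D w) dx dy finW DW mu_x mu_y.
set rhs := _ * _ => ssmD.
have rhs_lt : rhs < (#|A|%:R ^+ #|` fset_set D|)^-1.
  (* When [D] or the discrepancy set is empty, [dist] is [None] and the bound is 0. *)
  rewrite /rhs; case distE : dist => [n|]; last by rewrite mulr0 invr_gt0.
  have rn : (r <= n)%N.
    by have [t [q [Dt dq <-]]] := dist_Some _ _ _ distE; exact: disc dq Dt.
  rewrite -div1r ltr_pdivlMr //; apply: le_lt_trans (fr n rn).
  apply: ler_pM; [by rewrite mulr_ge0 ?f0|exact: ltW| |].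
    by apply: ler_wpM2r; [exact: f0|rewrite ler_nat].
  exact: ler_weXn2l.
have cond_y : 0 < condp mu (cyl (restr D w)) (cyl dy).
  move: ssmD; rewrite ler_distl => /andP[_ le_xy].
  by have := lt_le_trans rhs_lt (le_trans cond_x le_xy); rewrite ltrDr.
have {}cond_x : 0 < condp mu (cyl (restr D w)) (cyl dx).
  by apply: lt_le_trans cond_x; rewrite invr_gt0.
have pick (v : fullconf 2 A) : msupport mu v ->
    0 < condp mu (cyl (restr D w)) (cyl (restr (boundary W) v)) ->
    exists v', [/\ msupport mu v', forall q, D q -> v' q = w q &
                   forall q, ~ W q -> v' q = v q].
  move=> mv; rewrite condp_gt0; try exact: measurable_cyl; last exact: mv.
  move=> /(msupport_pos _ _ (measurableI _ _ (measurable_cyl _ _ finD)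
    (measurable_cyl _ _ finbW))) [z [mz [/cyl_restrP zw /cyl_restrP zv]]].
  (* The point [z] agrees with [v] only on the boundary of [W]; splicing restores [v] everywhere
     outside [W]. *)
  exists (splice W z v); split.
  - exact: msupport_splice.
  - by move=> q Dq; rewrite splice_in ?zw//; exact: DW.
  - by move=> q /splice_out ->.
have [x' [mx' x'w x'x]] := pick x mx cond_x.
have [y' [my' y'w y'y]] := pick y my cond_y.
have WS q : S q -> ~ W q by move=> Sq [].
exists (splice P x' y'); split.
- apply: msupport_splice => // t bt.
  (* A boundary site of [P] in [S] carries the common value of [x] and [y]. Outside [S] it is at
     distance exactly r from [p], hence in [D], where both configurations carry [w]. *)
  have [St|nSt] := pselect (S t).
    by rewrite x'x ?y'y ?xy //; exact: WS.
  suff Dt : D t by rewrite x'w ?y'w.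
  split=> //=; have [q [/= qr _] tq] := boundary_neighbor _ _ bt.
  apply/eqP; rewrite eqn_leq; apply/andP; split.
    by apply: leq_trans (norm1_trans q t p) _; rewrite tq.
  by rewrite leqNgt; apply/negP => lt; case: bt => + _; apply.
- move=> q Sq; rewrite splice_out; last by case.
  by rewrite y'y ?xy //; exact: WS.
- rewrite splice_in; last by split; rewrite //= subrr norm1_0.
  by rewrite x'x // => -[/=]; rewrite subrr norm1_0.
- move=> q qr; rewrite splice_out => [|[/= lt _]].
    by rewrite y'y // => -[/= /andP[_]]; rewrite ltnNge qr.
  by move: lt; rewrite ltnNge (leq_trans _ qr) // -addnn leq_addr.
Qed.

(** Start from [y] and install the values of [x] on [U] site by site, adding the sites already
    treated to [S] so that they are preserved. Sites of [V] never change, being at distance at least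
    [g] from every site of [U]. *)
Lemma TSSM_gap_single_site {d} {A : alphabetType} (X : set (fullconf d A)) g :
  (forall (p : site d) (S : set (site d)) (x y : fullconf d A),
    finite_set S -> X x -> X y -> (forall q, S q -> x q = y q) ->
    exists z, [/\ X z, forall q, S q -> z q = x q, z p = x p &
      forall q, (g <= norm1 (q - p)%R)%N -> z q = y q]) ->
  TSSM_gap X g.
Proof.
move=> single U V S u v s finU finV finS UV [x [[Xx xu] xs]] [y [[Xy ys] yv]].
have xyS : forall q, S q -> x q = y q.
  by apply/cyl_restrP; exact: etrans xs (esym ys).
suff [z [Xz zS zU zV]] : exists z, [/\ X z, forall q, S q -> z q = x q,
    forall q, U q -> z q = x q & forall q, V q -> z q = y q].
  exists z; split; last by rewrite -[v]yv; exact: restr_ext.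
  split; last by rewrite -[s]xs; exact: restr_ext.
  by split=> //; rewrite -[u]xu; exact: restr_ext.
have {}UV p q : U p -> V q -> (g <= norm1 (q - p)%R)%N.
  by rewrite norm1B => Up Vq; exact: dist_geP UV Up Vq.
have [l Ul] := (finite_seqP _).1 finU; rewrite {}Ul in UV *.
elim: l UV => [|p l IHl] UV; first by exists y; split=> // q /xyS.
have [|z [Xz zS zl zV]] := IHl.
  by move=> a b al; apply: UV; rewrite /= inE [_ \in _]al orbT.
have finSl : finite_set (S `|` [set` l]).
  by rewrite finite_setU; split=> //; exact: finite_seq.
have [|z' [Xz' z'S z'p z'V]] := single p _ x z finSl Xx Xz.
  by move=> q [/zS|/zl].
exists z'; split=> // [q Sq|q|q Vq]; first by apply: z'S; left.
  by rewrite /= inE => /orP[/eqP -> //|ql]; apply: z'S; right.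
by rewrite z'V ?zV //; apply: UV => //=; rewrite inE eqxx.
Qed.

(** * Choice of the radius, and conclusion *)

Lemma exponential_rate_small {R : realType} (a : nat) (C alpha : R) :
  (0 < a)%N -> 0 < C -> 4 * ln (a%:R : R) < alpha ->
  exists2 r, (0 < r)%N & forall n, (r <= n)%N ->
    (4 * r + 2)%:R * (C * expR (- alpha * n%:R)) * a%:R ^+ (4 * r + 2) < 1.
Proof.
move=> a0 C0; set L := ln _ => alphaL.
have L0 : 0 <= L by rewrite ln_ge0 // ler1n.
have aL : a%:R = expR L :> R by rewrite lnK // posrE ltr0n.
(* The factor |A|^(4r + 2) grows like exp(4Lr), so at n = r the product is of order r exp(-beta r);
   larger n only makes it smaller. *)
pose beta := alpha - 4 * L; have beta0 : 0 < beta by rewrite subr_gt0.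
(* Chosen so that r > K gives 6r C exp(2L) < (beta r)^2 / 2, the quadratic term of exp(beta r); the
   6r bounds 4r + 2. *)
pose K := 12 * C * expR L ^+ 2 / beta ^+ 2.
have [r r0 Kr] : exists2 r, (0 < r)%N & K < r%:R.
  by exists (Num.truncn K).+1 => //; exact: truncnS_gt.
exists r => // n rn.
have le_r : expR (- alpha * n%:R) <= expR (- alpha * r%:R).
  by rewrite ler_expR ler_wnM2l ?ler_nat // oppr_le0; lra.
have r6 : (4 * r + 2)%:R <= 6 * r%:R :> R by rewrite -natrM ler_nat; lia.
have powE : a%:R ^+ (4 * r + 2) = expR L ^+ 2 * expR (4 * L * r%:R) :> R.
  by rewrite aL exprD mulrC -!expRM_natl; congr (_ * expR _); rewrite natrM; ring.
have expE : expR (- alpha * r%:R) * expR (4 * L * r%:R) = (expR (beta * r%:R))^-1.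
  by rewrite -expRD -expRN; congr expR; rewrite /beta; ring.
have E0 : 0 <= expR L ^+ 2 by rewrite exprn_ge0 ?expR_ge0.
apply: (@le_lt_trans _ _ (6 * r%:R * (C * expR L ^+ 2) / expR (beta * r%:R))).
  rewrite powE -expE.
  rewrite (_ : _ * _ * _ = (4 * r + 2)%:R * (C * expR L ^+ 2) *
    (expR (- alpha * n%:R) * expR (4 * L * r%:R))); last by ring.
  have CE0 : 0 <= C * expR L ^+ 2 by rewrite mulr_ge0 // ltW.
  apply: ler_pM; [by rewrite mulr_ge0|by rewrite mulr_ge0 ?expR_ge0| |].
    exact: ler_wpM2r.
  by apply: ler_wpM2r => //; exact: expR_ge0.
rewrite ltr_pdivrMr ?expR_gt0 // mul1r.
have br0 : 0 <= beta * r%:R by apply: mulr_ge0 => //; exact: ltW.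
apply: (lt_le_trans _ (expR_ge1Dxn 1 br0)).
have : K * beta ^+ 2 * r%:R <= r%:R * beta ^+ 2 * r%:R.
  by apply: ler_wpM2r => //; apply: ler_wpM2r; [exact/exprn_ge0/ltW|exact: ltW].
have beta2 : beta ^+ 2 != 0 by rewrite expf_neq0 ?gt_eqF.
rewrite /K mulfVK // (_ : (2)`!%:R = 2 :> R) //.
rewrite (_ : (_ * r%:R) ^+ 2 = r%:R * beta ^+ 2 * r%:R); last by ring.
rewrite (_ : 12 * C * _ * _ = 2 * (6 * r%:R * (C * expR L ^+ 2))); last by ring.
by set u := r%:R * _ * _; set v := 6 * _ * _; lra.
Qed.

Theorem theorem5p2 (R : realType) (A : alphabetType)
    (mu : probability (borel_fullconf 2 A) R) (C alpha : R) :
  is_MRF mu ->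
  0 < C ->
  4 * ln (#|A|%:R : R) < alpha ->
  SSM mu (fun n : nat => C * expR (- alpha * n%:R)) ->
  TSSM (msupport mu).
Proof.
move=> mrf C0 alphaA ssm; split; first by apply: shift_space_msupport; case: mrf.
have A0 : (0 < #|A|)%N by apply/card_gt0P; exists point.
have [r r0 small] := exponential_rate_small _ _ _ A0 C0 alphaA.
exists r.*2; apply: TSSM_gap_single_site.
exact: single_site mrf ssm r0 small.
Qed.
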